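(* (All-distinct decks.) Let $D$ be a deck of $n\ge1$ cards with pairwise distinct values. Then $$\kappa_1(D)=\frac{n}{4\,N}\sum_{\pi\in S_n}|\operatorname{asc}(\pi)-\operatorname{des}(\pi)|=\frac{n}{4\,N}\sum_{d=0}^{n-1}\left\langle{n\atop d}\right\rangle|n-1-2d|,$$ where $N=n!$ is the number of reorderings of $D$.
   Context: A deck of $n$ cards is a function $D$ from $\{1,\dots,n\}$ to a finite totally ordered set of values (the order is arbitrary). $\mathcal O(D)$ is the set of reorderings of $D$, $N=\#\mathcal O(D)$, and $n_v$ is the number of cards of value $v$ in $D$. For $\pi\in S_n$, $\operatorname{des}(\pi)=\#\{1\le i\le n-1:\pi(i)>\pi(i+1)\}$ and $\operatorname{asc}(\pi)=\#\{1\le i\le n-1:\pi(i)<\pi(i+1)\}$. The Eulerian number $\left\langle{n\atop d}\right\rangle$ is the number of $\pi\in S_n$ with $\operatorname{des}(\pi)=d$. A $u$-$v$ digraph in $D$ is an index $i$ with $D(i)=u$, $D(i+1)=v$. A $u$-$v$ pair in $D$ is a pair $(i,j)$ with $i<j$, $D(i)=u$, $D(j)=v$. Define $W(D,u,v)=\#\{u\text{-}v\text{ digraphs in }D\}-\#\{v\text{-}u\text{ digraphs in }D\}$, $Z(D,u,v)=\#\{u\text{-}v\text{ pairs in }D\}-\#\{v\text{-}u\text{ pairs in }D\}$, and for $D'\in\mathcal O(D)$ $$c_1(D,D')=\frac{n}{2N}\sum_{u<v}\frac{W(D,u,v)Z(D',u,v)}{n_un_v},\qquad \kappa_1(D)=\frac12\sum_{D'\in\mathcal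 O(D)}|c_1(D,D')|.$$ ($\kappa_1(D)$ is the coefficient of $a^{-1}$ in the variation distance from uniform after an $a$-shuffle of $D$.) *)

(* Defs.v *)
From HB Require Import structures.
From mathcomp Require Import all_boot all_order all_algebra all_fingroup.

Set Implicit Arguments.
Unset Strict Implicit.
Unset Printing Implicit Defensive.

Import Order.TTheory GRing.Theory Num.Theory.
Local Open Scope ring_scope.

(* Positions are 0-based: position i of {1, ..., n} is the ordinal i - 1.     *)
Definition deck (disp : Order.disp_t) (V : finOrderType disp) (n : nat) :=
  {ffun 'I_n -> V}.

Section Decks.
Variables (disp : Order.disp_t) (V : finOrderType disp) (n : nat).
Implicit Types (D : deck V n) (u v : V).

(* A set of decks, not of permutations: arrangements that differ only by      *)
(* exchanging cards of equal value are counted once.                          *)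
Definition reorderings D : {set deck V n} :=
  [set [ffun i => D (s i)] | s : 'S_n].

Definition ncards D v : nat := #|[set i : 'I_n | D i == v]|.

Definition digraphs D u v : {set 'I_n} :=
  [set i : 'I_n | (D i == u) &&
     [exists j : 'I_n, (j == i.+1 :> nat) && (D j == v)]].

Definition pairs D u v : {set 'I_n * 'I_n} :=
  [set p : 'I_n * 'I_n | [&& (p.1 < p.2)%N, D p.1 == u & D p.2 == v]].

Definition W D u v : int := #|digraphs D u v|%:Z - #|digraphs D v u|%:Z.

Definition Z D u v : int := #|pairs D u v|%:Z - #|pairs D v u|%:Z.

(* The sum runs over all of V; a value u or v that does not occur in D        *)
(* contributes 0, as then W D u v = 0 (and x / 0 = 0).                        *)
Definition c1 D D' : rat :=
  n%:R / (2 * #|reorderings D|%:R) *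
  \sum_(u : V) \sum_(v : V | (u < v)%O)
    (W D u v)%:~R * (Z D' u v)%:~R / ((ncards D u)%:R * (ncards D v)%:R).

Definition kappa1 D : rat := 1 / 2 * \sum_(D' in reorderings D) `|c1 D D'|.

End Decks.

Definition des (n : nat) (pi : 'S_n) : nat :=
  #|[set i : 'I_n |
     [exists j : 'I_n, (j == i.+1 :> nat) && (pi j < pi i)%N]]|.

Definition asc (n : nat) (pi : 'S_n) : nat :=
  #|[set i : 'I_n |
     [exists j : 'I_n, (j == i.+1 :> nat) && (pi i < pi j)%N]]|.

Definition eulerian (n d : nat) : nat := #|[set pi : 'S_n | des pi == d]|.

(* Main.v *)
(* Both W and Z are antisymmetric in (u, v), so the sum over u < v defining
   c_1 equals a sum over all ordered pairs (u, v) weighted by the number of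
   u-v digraphs of D, i.e. a sum over adjacent positions of D. When the cards
   are distinct and D' = D o s, the term of positions i, i + 1 is +1 or -1
   according as s^-1 has an ascent or a descent at i, whence
   c_1(D, D') = n / (2 N) (asc (s^-1) - des (s^-1)). The second formula uses
   asc + des = n - 1 and groups the permutations by number of descents. *)
Require Import Defs.
From HB Require Import structures.
From mathcomp Require Import all_boot all_order all_algebra all_fingroup.
From mathcomp Require Import ring lra.

Set Implicit Arguments.
Unset Strict Implicit.
Unset Printing Implicit Defensive.

Import Order.TTheory GRing.Theory Num.Theory.
Local Open Scope ring_scope.

(** A position has at most one successor, so the existential equals a sum with at most one term.
    This puts digraphs, ascents and descents in one common form. *)
Lemma card_succ_exists (n : nat) (P : rel 'I_n) :
  #|[set i : 'I_n | [exists j : 'I_n, (j == i.+1 :> nat) && P i j]]| =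
  (\sum_(i : 'I_n) \sum_(j : 'I_n | j == i.+1 :> nat) P i j)%N.
Proof.
rewrite cardE -sum1_size big_enum big_mkcond /=; apply: eq_bigr => i _.
rewrite inE; case: existsP => [[j /andP[ji Pij]]|nexj].
  rewrite (bigD1 j) //= Pij big1 // => k /andP[/eqP ki /eqP].
  by case; apply: val_inj; rewrite /= ki (eqP ji).
rewrite big1 // => j ji; case Pij: (P i j) => //.
by case: nexj; exists j; rewrite ji.
Qed.

Lemma card_digraphs (disp : Order.disp_t) (V : finOrderType disp) (n : nat)
    (D : deck V n) (u v : V) :
  #|digraphs D u v| = (\sum_(i : 'I_n) \sum_(j : 'I_n | j == i.+1 :> nat)
                         ((D i == u) && (D j == v)))%N.
Proof.
rewrite -(card_succ_exists (fun i j => (D i == u) && (D j == v))).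
apply: eq_card => i; rewrite !inE; apply/andP/existsP.
  by case=> Di /existsP[j /andP[ji Dj]]; exists j; rewrite ji Di Dj.
case=> j /and3P[ji Di Dj]; split=> //.
by apply/existsP; exists j; rewrite ji.
Qed.

(** Once the sums are exchanged, adjacent positions [i], [j] contribute only at [u = D i],
    [v = D j]. *)
Lemma sum_digraphs (disp : Order.disp_t) (V : finOrderType disp) (n : nat)
    (D : deck V n) (F : V -> V -> rat) :
  \sum_(u : V) \sum_(v : V) #|digraphs D u v|%:R * F u v =
  \sum_(i : 'I_n) \sum_(j : 'I_n | j == i.+1 :> nat) F (D i) (D j).
Proof.
under eq_bigr do under eq_bigr do
  (rewrite card_digraphs natr_sum mulr_suml;
   under eq_bigr do rewrite natr_sum mulr_suml).
under eq_bigr do rewrite exchange_big /=.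
rewrite exchange_big /=; apply: eq_bigr => i _.
under eq_bigr do rewrite exchange_big /=.
rewrite exchange_big /=; apply: eq_bigr => j _.
rewrite (bigD1 (D i)) //= [X in _ + X]big1 ?addr0 => [|u /negPf ui].
  rewrite (bigD1 (D j)) //= [X in _ + X]big1 ?addr0 => [|v /negPf vj].
    by rewrite !eqxx mul1r.
  by rewrite [D j == v]eq_sym vj andbF mul0r.
by apply: big1 => v _; rewrite [D i == u]eq_sym ui mul0r.
Qed.

(** Exchanging the names [u] and [v] turns the [- d v u] half into the sum over [v < u]; the
    diagonal vanishes because [F u u = 0]. *)
Lemma sum_lt_antisym (disp : Order.disp_t) (V : finOrderType disp)
    (d F : V -> V -> rat) (F_antisym : forall u v, F v u = - F u v) :
  \sum_(u : V) \sum_(v : V | (u < v)%O) (d u v - d v u) * F u v =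
  \sum_(u : V) \sum_(v : V) d u v * F u v.
Proof.
have Fuu u : F u u = 0 by have := F_antisym u u; lra.
have -> : \sum_(u : V) \sum_(v : V) d u v * F u v =
    \sum_(u : V) \sum_(v : V | (u < v)%O) d u v * F u v +
    \sum_(u : V) \sum_(v : V | (v < u)%O) d u v * F u v.
  rewrite -big_split /=; apply: eq_bigr => u _.
  rewrite [X in _ = X + _]big_mkcond [X in _ = _ + X]big_mkcond -big_split /=.
  apply: eq_bigr => v _; case: ltgtP => [||<-]; rewrite ?addr0 ?add0r //.
  by rewrite Fuu mulr0.
rewrite [X in _ = _ + X](exchange_big_dep xpredT) //= -big_split /=.
apply: eq_bigr => u _; rewrite -big_split /=; apply: eq_bigr => v _.
by rewrite mulrBl [F v u]F_antisym mulrN.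
Qed.

Lemma Z_antisym (disp : Order.disp_t) (V : finOrderType disp) (n : nat)
    (D : deck V n) (u v : V) : Z D v u = - Z D u v.
Proof. by rewrite /Z opprB. Qed.

Section DistinctCards.
Variables (disp : Order.disp_t) (V : finOrderType disp) (n : nat).
Variables (D : deck V n) (D_inj : injective D).

Definition shuffled (s : 'S_n) : deck V n := [ffun i => D (s i)].

Lemma shuffled_inj : injective shuffled.
Proof.
move=> s t /ffunP st; apply/permP => i; apply: D_inj.
by have := st i; rewrite !ffunE.
Qed.

Lemma card_reorderings : #|reorderings D| = n`!.
Proof. by rewrite (card_imset _ shuffled_inj) card_Sn. Qed.

Lemma ncards1 (i : 'I_n) : ncards D (D i) = 1%N.
Proof.
rewrite /ncards -(cards1 i); apply: eq_card => j.
by rewrite !inE (inj_eq D_inj).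
Qed.

(** The card [D i] occurs in [shuffled s] only at position [s^-1 i], which leaves a single candidate
    pair. *)
Lemma card_pairs_shuffled (s : 'S_n) (i j : 'I_n) :
  #|pairs (shuffled s) (D i) (D j)| = ((s^-1)%g i < (s^-1)%g j)%N.
Proof.
have memE p : (p \in pairs (shuffled s) (D i) (D j)) =
    ((s^-1)%g i < (s^-1)%g j)%N && (p == ((s^-1)%g i, (s^-1)%g j)).
  case: p => k l; rewrite inE !ffunE !(inj_eq D_inj) xpair_eqE /=.
  rewrite !(can2_eq (permK s) (permKV s)).
  by case: eqP => [->|]; case: eqP => [->|]; rewrite ?andbF.
case: ltnP memE => _ memE.
  by rewrite /= -(card1 ((s^-1)%g i, (s^-1)%g j)); apply: eq_card => p; rewrite memE.
by apply: eq_card0 => p; rewrite memE.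
Qed.

Lemma c1_shuffled (s : 'S_n) :
  c1 D (shuffled s) =
  n%:R / (2 * #|reorderings D|%:R) *
  ((asc (s^-1)%g)%:R - (des (s^-1)%g)%:R).
Proof.
rewrite /c1; congr (_ * _).
pose F u v : rat :=
  (Z (shuffled s) u v)%:~R / ((ncards D u)%:R * (ncards D v)%:R).
have F_antisym u v : F v u = - F u v.
  by rewrite /F Z_antisym rmorphN mulNr [_%:R * _]mulrC.
transitivity (\sum_(u : V) \sum_(v : V | (u < v)%O)
    (#|digraphs D u v|%:R - #|digraphs D v u|%:R) * F u v).
  apply: eq_bigr => u _; apply: eq_bigr => v _.
  by rewrite /W rmorphB /= !pmulrn mulrA.
rewrite (sum_lt_antisym (fun u v => #|digraphs D u v|%:R) F_antisym).
rewrite sum_digraphs /asc /des.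
rewrite (card_succ_exists (fun i j => ((s^-1)%g i < (s^-1)%g j)%N)).
rewrite (card_succ_exists (fun i j => ((s^-1)%g j < (s^-1)%g i)%N)).
rewrite !natr_sum -sumrB; apply: eq_bigr => i _.
rewrite !natr_sum -sumrB; apply: eq_bigr => j _.
(* All denominators are 1, and [Z] is a difference of two indicators: ascent minus descent of [s^-1]
   at [i]. *)
by rewrite /F /Z !ncards1 !card_pairs_shuffled !mulr1n mulr1 divr1 rmorphB /= !pmulrn.
Qed.

Lemma kappa1_asc_des :
  kappa1 D = n%:R / (4 * #|reorderings D|%:R) *
             \sum_(pi : 'S_n) `|(asc pi)%:R - (des pi)%:R : rat|.
Proof.
rewrite /kappa1 {1}/reorderings big_imset /=; last by move=> s t _ _ /shuffled_inj.
(* Summing over inverses cancels the [s^-1] in the formula for [c1]. *)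
rewrite (reindex_inj invg_inj) /= mulr_sumr mulr_sumr.
apply: eq_big => [pi|pi _]; first by rewrite inE.
rewrite -/(shuffled _) c1_shuffled invgK normrM mulrA; congr (_ * _).
rewrite ger0_norm ?divr_ge0 ?mulr_ge0 ?ler0n //.
by field; rewrite card_reorderings pnatr_eq0 -lt0n fact_gt0.
Qed.

End DistinctCards.

(** Every position but the last has a successor, and injectivity of [pi] makes the step there either
    an ascent or a descent. *)
Lemma asc_add_des (n : nat) (pi : 'S_n) : (asc pi + des pi)%N = n.-1.
Proof.
rewrite /asc /des (card_succ_exists (fun i j => (pi i < pi j)%N)).
rewrite (card_succ_exists (fun i j => (pi j < pi i)%N)) -big_split /=.
case: n pi => [|n] pi; first by rewrite big_ord0.
(* The last position has no successor, so its inner sums are empty. *)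
rewrite big_ord_recr /= [X in (_ + X)%N](_ : _ = 0%N) ?addn0; last first.
  by rewrite !big1 // => j /eqP jn; have := ltn_ord j; rewrite jn ltnn.
rewrite -[RHS](card_ord n) -sum1_card; apply: eq_bigr => i _.
rewrite -big_split /=.
(* [lift ord0 i] has value [i.+1]: it is the successor of [i]. *)
rewrite (big_pred1 (lift ord0 i)) => [|j]; last first.
  by rewrite -[RHS](inj_eq val_inj).
by case: ltngtP => // /val_inj /perm_inj /(congr1 val) /eqP; rewrite ltn_eqF.
Qed.

Lemma sum_asc_des_eulerian (n : nat) (n_gt0 : (0 < n)%N) :
  \sum_(pi : 'S_n) `|(asc pi)%:R - (des pi)%:R : rat| =
  \sum_(0 <= d < n) (eulerian n d)%:R * `|n%:R - 1 - 2 * d%:R|.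
Proof.
(* This bound lets the descent number serve as an ordinal index for the partition of the
   permutations. *)
have des_lt (pi : 'S_n) : (des pi < n)%N.
  by rewrite -[ltnRHS](prednK n_gt0) ltnS -(asc_add_des pi) leq_addl.
rewrite big_mkord (partition_big (fun pi => Ordinal (des_lt pi)) xpredT) //=.
apply: eq_bigr => d _; rewrite /eulerian -sum1_card natr_sum mulr_suml.
apply: eq_big => [pi|pi /eqP <- /=]; first by rewrite inE -val_eqE.
(* With [d = des pi], this makes [n - 1 - 2 d] equal to [asc pi - des pi]. *)
have -> : n%:R = 1 + (asc pi)%:R + (des pi)%:R :> rat.
  by rewrite -addrA -natrD asc_add_des nat1r prednK.
by rewrite mul1r; congr (`|_|); ring.
Qed.

Theorem mainTheorem6 (disp : Order.disp_t) (V : finOrderType disp) (n : nat)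
    (D : deck V n) (hn : (1 <= n)%N) (hD : injective D) :
  #|reorderings D| = n`! /\
  kappa1 D = n%:R / (4 * #|reorderings D|%:R) *
             \sum_(pi : 'S_n) `|(asc pi)%:R - (des pi)%:R : rat| /\
  n%:R / (4 * #|reorderings D|%:R) *
    \sum_(pi : 'S_n) `|(asc pi)%:R - (des pi)%:R : rat| =
  n%:R / (4 * #|reorderings D|%:R) *
    \sum_(0 <= d < n) (eulerian n d)%:R * `|n%:R - 1 - 2 * d%:R|.
Proof.
split; first exact: card_reorderings.
split; first exact: kappa1_asc_des.
by rewrite sum_asc_des_eulerian.
Qed.
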